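(* Let $X$ be a compact Hausdorff space with at least three points, and suppose there is a point $x\in X$ such that the subspace $X\setminus\{x\}$ has a maximal $N$-point compactification for some $N\in\mathbb{N}=\{0,1,2,\dots\}$. Then $X$ is topologically reconstructible; that is, every topological space $Y$ with $\mathcal{D}(Y)=\mathcal{D}(X)$ is homeomorphic to $X$.
   Context: An $N$-point compactification of a space $Z$ is a Hausdorff compactification $\gamma Z$ (a compact Hausdorff space containing $Z$ as a dense subspace) with $|\gamma Z\setminus Z|=N$; a finite compactification is an $N$-point compactification for some $N\in\mathbb{N}$. An $N$-point compactification of $Z$ is maximal if every finite compactification $\gamma Z$ of $Z$ satisfies $|\gamma Z\setminus Z|\le N$. By convention, a compact Hausdorff space has a maximal $0$-point compactification (itself). For a topological space $X$, the deck is $\mathcal{D}(X)=\{[X\setminus\{x\}] : x\in X\}$, where $[Z]$ denotes the homeomorphism class of $Z$ and $X \setminus \{x\}$ carries the subspace topology (the deck is a set, without multiplicities); the spaces $X\setminus\{x\}$ are the cards of $X$. $X$ is topologically reconstructible if $\mathcal{D}(X)=\mathcal{D}(Y)$ implies $X\cong Y$ for every topological space $Y$. Standing convention: all spaces considered have at least three points. *)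

(* Defs.v *)
From HB Require Import structures.
From mathcomp Require Import all_boot all_order.
From mathcomp Require Import all_classical topology.

Set Implicit Arguments.
Unset Strict Implicit.
Unset Printing Implicit Defensive.

Local Open Scope classical_set_scope.
Local Open Scope card_scope.

Definition homeomorphic (X Y : topologicalType) : Prop :=
  exists (f : X -> Y) (g : Y -> X),
    [/\ continuous f, continuous g, cancel f g & cancel g f].

(* The second clause says that the topology of Z is the one induced by e, so Z
   is identified with the subspace range e of K. *)
Definition embedding (Z K : topologicalType) (e : Z -> K) : Prop :=
  injective e /\ @open Z = [set e @^-1` V | V in @open K].

Definition is_compactification (Z K : topologicalType) (e : Z -> K) : Prop :=
  [/\ hausdorff_space K, compact [set: K], embedding e & dense (range e)].

Definition npoint_compactification (N : nat) (Z K : topologicalType)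
    (e : Z -> K) : Prop :=
  is_compactification e /\ ~` range e #= `I_N.

(* No separate clause is needed for compact Hausdorff Z: there the identity is
   a 0-point compactification, and it is maximal because every compactification
   of such a Z is onto. *)
Definition maximal_npoint_compactification (N : nat) (Z K : topologicalType)
    (e : Z -> K) : Prop :=
  npoint_compactification N e /\
  forall (M : nat) (L : topologicalType) (i : Z -> L),
    npoint_compactification M i -> M <= N.

Definition has_maximal_npoint_compactification (N : nat)
    (Z : topologicalType) : Prop :=
  exists (K : topologicalType) (e : Z -> K), maximal_npoint_compactification N e.

(* X minus x, with the subspace topology that the library puts on set_type *)
Definition point_deleted (X : topologicalType) (x : X) : topologicalType :=
  set_type (~` [set x]).

(* Plain predicates, because topologicalType is too large to be the argument of
   set. *)
Definition homeo_class (Z : topologicalType) : topologicalType -> Prop :=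
  fun W => homeomorphic Z W.

Definition deck (X : topologicalType) : (topologicalType -> Prop) -> Prop :=
  fun C => exists x : X, C = homeo_class (point_deleted x).

Definition topologically_reconstructible (X : topologicalType) : Prop :=
  forall Y : topologicalType, deck X = deck Y -> homeomorphic X Y.

(* Main.v *)
(* Write n(x) for the supremum of the sizes of the finite compactifications of
   X \ {x}, and choose x with n(x) minimal.  If Y has the same deck as X then Y
   is Hausdorff, and if Y is moreover compact, a common card determines both X
   and Y as its one-point extension.  Suppose Y is not compact, and let Y \ {y}
   be homeomorphic to X \ {x}.  Besides the ends at y, the space Y \ {y} has an
   end at infinity, so y has fewer than n(x) local ends.  But y survives in a
   card Y \ {y'}, which embeds as an open subspace in X: hence some point of X
   has fewer than n(x) local ends, against minimality.

   Ends are counted by "stars" (Magill): disjoint open sets G_i whose union has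
   a compact complement, which ceases to be compact when any one G_i is added
   to it. *)
Require Import Defs.
From HB Require Import structures.
From mathcomp Require Import all_boot all_order.
From mathcomp Require Import all_classical topology.

Set Implicit Arguments.
Unset Strict Implicit.
Unset Printing Implicit Defensive.

Local Open Scope classical_set_scope.
Local Open Scope card_scope.

(** * Stars and the compactifications they define *)

Definition star (T : topologicalType) (A : set T) (I : finType)
    (G : I -> set T) : Prop :=
  [/\ forall i, open (G i) /\ G i `<=` A,
      forall i j, G i `&` G j !=set0 -> i = j,
      compact (A `\` \bigcup_i G i) &
      forall i, ~ compact (A `\` \bigcup_(j in [set~ i]) G j)].

(** Carrying [G] as a parameter lets the topology declared on this type depend on the star. *)
Definition star_ext (Z : topologicalType) (I : finType) (G : I -> set Z) :
  Type := (Z + I)%type.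

Section StarCompactification.
Context (Z : topologicalType) (I : finType) (G : I -> set Z).

Notation K := (star_ext G).

(* Neighbourhoods of the added point [inr i] contain a cocompact part of G_i, or
   equivalently of the complement of the other G_j, which for a star differs from
   G_i by a compact set. *)
Definition star_open (U : set K) : Prop :=
  open (inl @^-1` U : set Z) /\
  forall i, U (inr i) -> exists2 C : set Z, compact C &
    ~` (\bigcup_(j in [set~ i]) G j) `<=` C `|` inl @^-1` U.

Lemma star_openT : star_open setT.
Proof.
split; first exact: openT.
by move=> i _; exists set0; [exact: compact0|move=> z _; right].
Qed.

Lemma star_openI : setI_closed star_open.
Proof.
move=> U V [oU kU] [oV kV]; split; first exact: openI.
move=> i [/kU[C cC UC] /kV[D cD VD]].
exists (C `|` D); first exact: compactU.
by move=> z /[dup] /UC[?|?] /VD[?|?];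
  (by left; left) || (by left; right) || right.
Qed.

Lemma star_open_bigcup (J : Type) (U : J -> set K) :
  (forall j, star_open (U j)) -> star_open (\bigcup_j U j).
Proof.
move=> oU; split.
  by rewrite preimage_bigcup; apply: bigcup_open => j _; case: (oU j).
move=> i [j _ /(proj2 (oU j))[C cC UC]]; exists C => // z /UC[?|?].
  by left.
by right; exists j.
Qed.

HB.instance Definition _ := Choice.copy K (Z + I)%type.
HB.instance Definition _ :=
  isOpenTopological.Build K star_openT star_openI star_open_bigcup.

Let inlK : Z -> K := inl.

Lemma star_open_inl (O : set Z) : open O -> open (inlK @` O).
Proof.
move=> oO; split; last by move=> i [].
suff -> : inl @^-1` (inlK @` O) = O by [].
by apply/seteqP; split=> [z [y Oy [<-]]|z Oz] //; exists z.
Qed.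

Lemma star_inl_continuous : continuous inlK.
Proof. by apply/continuousP => U []. Qed.

Lemma star_embedding : embedding inlK.
Proof.
split; first by move=> x y [].
apply/seteqP; split=> [O oO|_ [U [oU _] <-]] //.
exists (inlK @` O); first exact: star_open_inl.
by apply/seteqP; split=> [z [y Oy [<-]]|z Oz] //; exists z.
Qed.

Hypothesis Gstar : star setT G.
Hypothesis ZT2 : hausdorff_space Z.
Hypothesis Zlc : forall z : Z, exists2 D, nbhs z D & compact D.

(** Two points of [Z] are separated in [Z], a point and an end by the interior and the complement of
    a compact neighbourhood, two ends by their members [G i] with the ends added. *)
Lemma star_hausdorff : hausdorff_space K.
Proof.
have [oG GI cK _] := Gstar.
have sep_inl_inr z i : exists A B : set K,
    [/\ A (inl z), B (inr i), open A, open B & A `&` B = set0].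
  have [D zD cD] := Zlc z.
  exists (inlK @` D°), (~` (inlK @` D)); split.
  - by exists z.
  - by case.
  - by apply: star_open_inl; exact: open_interior.
  - have -> : @open K = star_open by [].
    split.
      suff -> : inl @^-1` (~` (inlK @` D)) = ~` D.
        by apply: closed_openC; exact: compact_closed.
      apply/seteqP; split=> y; first by move=> ny Dy; apply: ny; exists y.
      by move=> nDy [w Dw [wy]]; apply: nDy; rewrite -wy.
    move=> j _; exists D => // y _; have [|nDy] := pselect (D y); first by left.
    by right=> -[w Dw [wy]]; apply: nDy; rewrite -wy.
  - apply/seteqP; split=> // _ [[y /interior_subset Dy <-]]; apply.
    by exists y.
suff sep x y : x != y -> exists A B : set K,
    [/\ A x, B y, open A, open B & A `&` B = set0].
  rewrite open_hausdorff => x y /sep[A [B [Ax By oA oB AB0]]].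
  by exists (A, B); split; rewrite ?inE //; exact/eqP.
case: x y => [z|i] [w|j] xy.
- have zw : z != w by apply: contraNneq xy => ->.
  move: ZT2; rewrite open_hausdorff => /(_ _ _ zw).
  move=> [[A B] /= [zA wB] [oA oB /eqP AB0]].
  exists (inlK @` A), (inlK @` B); split; try exact: star_open_inl.
  + by exists z => //; exact: set_mem.
  + by exists w => //; exact: set_mem.
  + apply/seteqP; split=> // _ [[a Aa <-] [b Bb [ba]]].
    have : (A `&` B) a by split => //; rewrite -ba.
    by rewrite AB0.
- exact: sep_inl_inr.
- have [A [B [? ? ? ? AB0]]] := sep_inl_inr w i.
  by exists B, A; split=> //; rewrite setIC.
- have ij : i <> j by move=> ij; rewrite ij eqxx in xy.
  pose V i := [set k : K | match k with inl z => G i z | inr j => j = i end].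
  have oV k : open (V k).
    have -> : @open K = star_open by [].
    split; first by have [] := oG k.
    (* Off the other members, only the compact remainder of the star lies outside [G k]. *)
    move=> _ ->; exists (setT `\` \bigcup_i G i) => // z nz.
    have [|nGz] := pselect (G k z); [by right|left]; split=> // -[l _ Glz].
    by apply: nz; exists l => //= lk; apply: nGz; rewrite -lk.
  exists (V i), (V j); split=> //.
  apply/seteqP; split=> // -[z|k] [].
    by move=> Giz Gjz; apply: ij; apply: GI; exists z.
  by move=> /= -> ji; apply: ij.
Qed.

(** The space is the compact remainder of the star plus finitely many cells. A cell is compact
    because a neighbourhood of its end covers all but a compact part of it. *)
Lemma star_compact : compact [set: K].
Proof.
have [oG GI cK _] := Gstar.
pose cell i : set K := inlK @` (~` \bigcup_(j in [set~ i]) G j) `|` [set inr i].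
have cell_compact i : compact (cell i).
  apply/compact_near_coveringP => J F P FF FP.
  have /FP[[U S] /= [[W [oW Wi WU]] FS UP]] : cell i (inr i) by right.
  have [C cC iC] := proj2 oW _ Wi.
  (* [C] is cut down to the cell, since the covering hypothesis speaks only of points of the
     cell. *)
  have cC' : compact (inlK @` (C `&` ~` \bigcup_(j in [set~ i]) G j)).
    apply: continuous_compact.
      by apply: continuous_subspaceT; exact: star_inl_continuous.
    apply: compact_closedI => //; apply: open_closedC.
    by apply: bigcup_open => j _; have [] := oG j.
  have : \forall k \near F,
      inlK @` (C `&` ~` \bigcup_(j in [set~ i]) G j) `<=` P k.
    move/compact_near_coveringP : cC'; apply => _ [z [_ Cz] <-].
    by apply: FP; left; exists z.
  move=> FC; near=> k.
  have Sk : S k by near: k.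
  move=> _ [[z nz <-]|->].
    have [Cz|Wz] := iC _ nz; first by apply: (near FC k) => //; exists z.
    by apply: (UP (_, _)); split => //; exact: WU.
  by apply: (UP (_, _)); split => //; exact: WU.
have -> : [set: K] = inlK @` (setT `\` \bigcup_i G i) `|`
    \big[setU/set0]_(i : I) cell i.
  rewrite -(bigcup_pred predT); apply/seteqP; split=> // -[z|i] _; last first.
    by right; exists i => //; right.
  have [[i _ Giz]|nz] := pselect ((\bigcup_i G i) z); last by left; exists z.
  right; exists i => //; left; exists z => // -[j /= ji Gjz].
  by apply: ji; apply: GI; exists z.
apply: compactU.
  apply: continuous_compact => //.
  by apply: continuous_subspaceT; exact: star_inl_continuous.
exact: bigsetU_compact.
Unshelve. all: by end_near. Qed.

(** A neighbourhood of [inr i] missing [Z] would put the complement of the other members inside a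
    compact set, against the last clause of [star]. *)
Lemma star_dense : dense (range inlK).
Proof.
have [oG GI cK ncG] := Gstar.
move=> U [[z|i] Ui] [oU kU]; first by exists (inl z); split => //; exists z.
apply: contrapT => UI; apply: (ncG i).
have [C cC iC] := kU _ Ui.
apply: (subclosed_compact _ cC).
  rewrite setTD; apply: open_closedC.
  by apply: bigcup_open => j _; have [] := oG j.
move=> z; rewrite setTD => /iC[//|Uz].
by exfalso; apply: UI; exists (inl z); split => //; exists z.
Qed.

Lemma star_npoint_compactification : npoint_compactification #|I| inlK.
Proof.
split; first by split; [exact: star_hausdorff|exact: star_compact|
  exact: star_embedding|exact: star_dense].
have -> : ~` range inlK = inr @` [set: I].
  apply/seteqP; split=> [[z nr|i _]|_ [i _ <-] [z _]]; last by [].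
    by exfalso; apply: nr; exists z.
  by exists i.
apply: (card_eq_trans (inj_card_eq _)); first by move=> i j _ _ [].
rewrite (card_eqr card_II).
have -> : [set: 'I_#|I|] = enum_rank @` [set: I].
  by apply/seteqP; split=> // k _; exists (enum_val k) => //; rewrite enum_valK.
rewrite card_eq_sym; apply: inj_card_eq => i j _ _; exact: enum_rank_inj.
Qed.

End StarCompactification.

(** * Hausdorff separation and partial homeomorphisms *)

Lemma hausdorffP (T : topologicalType) : hausdorff_space T <->
  forall x y : T, x <> y -> exists U V : set T,
    [/\ open U, open V, U x, V y & U `&` V = set0].
Proof.
rewrite open_hausdorff; split=> T2 x y /eqP xy.
  have [[U V] /= [xU yV] [oU oV /eqP UV0]] := T2 _ _ xy.
  by exists U, V; split => //; exact: set_mem.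
have [|U [V [oU oV Ux Vy UV0]]] := T2 x y; first by [].
by exists (U, V); split; rewrite ?inE //; exact/eqP.
Qed.

Lemma hausdorff_inj (S T : topologicalType) (f : S -> T) :
  continuous f -> injective f -> hausdorff_space T -> hausdorff_space S.
Proof.
move=> /continuousP cf fI /hausdorffP T2; apply/hausdorffP => x y xy.
have [|U [V [oU oV Ux Vy UV0]]] := T2 (f x) (f y); first by move/fI.
exists (f @^-1` U), (f @^-1` V); split => //; try exact: cf.
by rewrite -preimage_setI UV0 preimage_set0.
Qed.

Lemma continuous_in_compact (S T : topologicalType) (A : set S) (f : S -> T) C :
  {in A, continuous f} -> C `<=` A -> compact C -> compact (f @` C).
Proof.
move=> cf CA; apply: continuous_compact; apply: continuous_in_subspaceT => x.
by rewrite inE => /CA xA; apply: cf; rewrite inE.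
Qed.

(* f and g are total functions that restrict to inverse homeomorphisms between
   A and B; their values elsewhere are junk. *)
Definition homeo_on (S T : topologicalType) (A : set S) (B : set T)
    (f : S -> T) (g : T -> S) : Prop :=
  [/\ {homo f : x / A x >-> B x}, {homo g : y / B y >-> A y},
      forall x, A x -> g (f x) = x, forall y, B y -> f (g y) = y &
      {in A, continuous f} /\ {in B, continuous g}].

Section HomeoOn.
Context (S T : topologicalType) (A : set S) (B : set T).
Context (f : S -> T) (g : T -> S) (fg : homeo_on A B f g).

Lemma homeo_on_sym : homeo_on B A g f.
Proof. by case: fg => ? ? ? ? []. Qed.

Lemma homeo_on_image C : C `<=` A -> f @` C = B `&` g @^-1` C.
Proof.
case: fg => fAB gBA gf fgK _ CA; apply/seteqP; split=> [_ [x Cx <-]|y [By Cgy]].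
  by split; [exact/fAB/CA|rewrite /= gf//; exact: CA].
by exists (g y) => //; exact: fgK.
Qed.

Lemma homeo_on_compact C : C `<=` A -> compact (f @` C) <-> compact C.
Proof.
case: (fg) => fAB gBA gf fgK [cf cg] CA; split => cC.
  have -> : C = g @` (f @` C).
    apply/seteqP; split=> [x Cx|_ [_ [x Cx <-] <-]]; last first.
      by rewrite gf//; exact: CA.
    by exists (f x); [exists x|rewrite gf//; exact: CA].
  by apply: (continuous_in_compact cg) cC => _ [x Cx <-]; exact/fAB/CA.
exact: (continuous_in_compact cf).
Qed.

Lemma homeo_on_open C : open B -> C `<=` A -> open C -> open (f @` C).
Proof.
case: (fg) => _ _ _ _ [cf cg] oB CA oC; rewrite homeo_on_image//.
by move/(continuous_inP g oB) : cg; exact.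
Qed.

Lemma star_homeo_on (I : finType) (G : I -> set S) : open B ->
  star A G -> star B (fun i => f @` G i).
Proof.
case: (fg) => fAB gBA gf fgK _ oB [oG GI cG ncG].
have GA i : G i `<=` A by case: (oG i).
have imD (P : set I) : B `\` \bigcup_(i in P) f @` G i =
    f @` (A `\` \bigcup_(i in P) G i).
  rewrite -image_bigcup [RHS]homeo_on_image; last by move=> x [].
  apply/seteqP; split=> y [By] /=.
    move=> nGy; split=> //; split; first exact: gBA.
    by move=> gGy; apply: nGy; exists (g y) => //; exact: fgK.
  move=> [_ nG]; split=> // -[x Gx xy]; apply: nG.
  by rewrite -xy gf//; case: Gx => i _ /GA.
split.
- move=> i; split; first by apply: homeo_on_open => //; case: (oG i).
  by move=> _ [x /GA Ax <-]; exact: fAB.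
- move=> i j [_ [[x Gx <-] [y Gy yx]]]; apply: GI; exists x; split=> //.
  by rewrite -(gf x) -?yx ?gf//; [exact: (GA _ _ Gy)|exact: (GA _ _ Gx)].
- by rewrite imD homeo_on_compact// => x [].
- by move=> i; rewrite imD homeo_on_compact//; move=> x [].
Qed.

End HomeoOn.

Lemma homeo_on_trans (S T U : topologicalType) (A : set S) (B : set T)
    (C : set U) (f : S -> T) (g : T -> S) (h : T -> U) (k : U -> T) :
  homeo_on A B f g -> homeo_on B C h k -> homeo_on A C (h \o f) (g \o k).
Proof.
move=> [fAB gBA gf fg [cf cg]] [hBC kCB kh hk [ch ck]]; split.
- by move=> x Ax; exact/hBC/fAB.
- by move=> x Cx; exact/gBA/kCB.
- by move=> x Ax /=; rewrite kh ?gf//; exact: fAB.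
- by move=> x Cx /=; rewrite fg ?hk//; exact: kCB.
- split=> x; rewrite inE => xA.
    by apply: continuous_comp; [apply: cf|apply: ch]; rewrite inE//; exact: fAB.
  by apply: continuous_comp; [apply: ck|apply: cg]; rewrite inE//; exact: kCB.
Qed.

Lemma homeomorphic_homeo_on (S T : topologicalType) : homeomorphic S T ->
  exists f g, homeo_on [set: S] [set: T] f g.
Proof.
move=> [f [g [cf cg fK gK]]]; exists f, g; split=> //.
by split=> x _; [exact: cf|exact: cg].
Qed.

Lemma set_type_homeo_on (T : topologicalType) (A : set T) (a : A) : open A ->
  exists g, homeo_on [set: A] A set_val g.
Proof.
move=> oA.
(* The point [a] is only the junk value of the inverse off [A]. *)
exists (fun x => if pselect (A x) is left Ax then SigSub (mem_set Ax) else a).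
split.
- by move=> x _; exact: set_valP.
- by [].
- move=> x _; case: pselect => [Ax|]; first exact: val_inj.
  by move=> nA; exfalso; apply: nA; exact: set_valP.
- by move=> y Ay; case: pselect.
- split; first by move=> x _; exact: initial_continuous.
  apply/(continuous_inP _ oA) => _ [V oV <-].
  suff -> : forall h : T -> A, (forall y, A y -> set_val (h y) = y) ->
    A `&` h @^-1` (set_val @^-1` V) = A `&` V.
  + exact: openI.
  + by move=> y Ay; case: pselect.
  + by move=> h hK; apply/seteqP; split=> y [Ay] /=; rewrite hK.
Qed.

(** * Cards of a compact Hausdorff space and star bounds *)

Lemma hausdorff_open_setC1 (T : topologicalType) :
  hausdorff_space T -> forall x : T, open (~` [set x]).
Proof.
move=> T2 x; apply: closed_openC; apply: accessible_closed_set1.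
exact: hausdorff_accessible.
Qed.

Lemma hausdorff_point_deleted (X : topologicalType) (x : X) :
  hausdorff_space X -> hausdorff_space (point_deleted x).
Proof. by apply: hausdorff_inj; [exact: initial_continuous|exact: val_inj]. Qed.

(** With [U] around [z] and [V] around [x] disjoint, the complement of [V] is a compact
    neighbourhood of [z] inside the card. *)
Lemma locally_compact_point_deleted (X : topologicalType) (x : X) :
  hausdorff_space X -> compact [set: X] ->
  forall z : point_deleted x, exists2 D, nbhs z D & compact D.
Proof.
move=> T2 Xc z; have Az := set_valP z.
have [g fg] := set_type_homeo_on z (hausdorff_open_setC1 T2 x).
have [_ gA valK gK _] := fg.
have [U [V [oU oV Uz Vx UV0]]] := (hausdorffP X).1 T2 _ _ Az.
have VA : ~` V `<=` ~` [set x] by move=> y nV yx; apply: nV; rewrite yx.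
exists (set_val @^-1` (~` V)).
  have : nbhs (set_val z) (~` V).
    apply: (@filterS _ _ _ U) => [y Uy Vy|]; last exact: open_nbhs_nbhs.
    by have : (U `&` V) y by []; rewrite UV0.
  exact: (@initial_continuous _ _ (@set_val _ (~` [set x]))).
apply/(homeo_on_compact fg) => //.
suff -> : set_val @` (set_val @^-1` (~` V) : set (point_deleted x)) = ~` V.
  by apply: (subclosed_compact _ Xc) => //; exact: open_closedC.
apply/seteqP; split=> [_ [w nV <-]//|w nV].
by exists (g w); rewrite ?/preimage /= gK//; exact: VA.
Qed.

(** This is [n(x) <= N] with ends counted by stars; as an upper bound it needs no value for an
    infinite supremum. *)
Definition star_bounded (X : topologicalType) (x : X) (N : nat) : Prop :=
  forall (I : finType) (G : I -> set X), star (~` [set x]) G -> #|I| <= N.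

(** Every star of the card yields a compactification with [#|I|] added points, and maximality
    applies to it. *)
Lemma maximal_npoint_star_bounded (X : topologicalType) (x a : X) N :
  hausdorff_space X -> compact [set: X] -> a <> x ->
  has_maximal_npoint_compactification N (point_deleted x) -> star_bounded x N.
Proof.
move=> T2 Xc ax [K [e [_ eN]]] I G Gstar.
have oA := hausdorff_open_setC1 T2 x.
pose z : point_deleted x := SigSub (mem_set (ax : (~` [set x]) a)).
have [g fg] := set_type_homeo_on z oA.
have Gstar' := star_homeo_on (homeo_on_sym fg) openT Gstar.
apply: eN (star_npoint_compactification Gstar' _ _).
  exact: hausdorff_point_deleted.
exact: locally_compact_point_deleted.
Qed.

(** A compact card has the empty star, a noncompact one the star whose only member is the whole
    card. This later forces the minimal bound to be positive. *)
Lemma star_exists (X : topologicalType) (x : X) : open (~` [set x]) ->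
  exists (I : finType) (G : I -> set X), star (~` [set x]) G.
Proof.
move=> oA; have [cA|ncA] := pselect (compact (~` [set x])).
  exists void, (fun=> set0); split; try by case.
  suff -> : \bigcup_(_ : void) set0 = set0 :> set X by rewrite setD0.
  by apply/seteqP; split=> // y [].
exists unit, (fun=> ~` [set x]); split.
- by move=> _; split.
- by move=> [] [].
- suff -> : ~` [set x] `\` \bigcup_(_ : unit) ~` [set x] = set0.
    exact: compact0.
  by apply/seteqP; split=> // y [xy]; apply; exists tt.
- move=> [].
  suff -> : \bigcup_(_ in [set~ tt]) ~` [set x] = set0 by rewrite setD0.
  by apply/seteqP; split=> // y [[] /(_ erefl)].
Qed.

(** * Localizing stars and transferring them between spaces *)

(** Shrinking the members to [U] enlarges each complement only by the compact complement of [U]. *)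
Lemma star_localize (X : topologicalType) (x : X) (U : set X) (I : finType)
    (G : I -> set X) :
  hausdorff_space X -> compact [set: X] -> open U -> U x ->
  star (~` [set x]) G -> star (~` [set x]) (fun i => G i `&` U).
Proof.
move=> T2 Xc oU Ux [oG GI cG ncG].
have splitD (P : set I) : ~` [set x] `\` \bigcup_(i in P) (G i `&` U) =
    (~` [set x] `\` \bigcup_(i in P) G i) `|` ~` U.
  rewrite -setI_bigcupl; apply/seteqP; split=> y.
    move=> [xy nGU]; have [Uy|] := pselect (U y); [left|by right].
    by split=> // Gy; apply: nGU.
  move=> [[xy nG]|nU]; first by split=> // -[].
  by split=> [yx|[]//]; apply: nU; rewrite yx.
split.
- by move=> i; have [oGi Gx] := oG i; split; [exact: openI|move=> y [/Gx]].
- by move=> i j [y [[Giy _] [Gjy _]]]; apply: GI; exists y.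
- rewrite splitD; apply: compactU => //.
  by apply: (subclosed_compact _ Xc) => //; exact: open_closedC.
- move=> i cE; apply: (ncG i).
  have -> : ~` [set x] `\` \bigcup_(j in [set~ i]) G j =
     (~` [set x] `\` \bigcup_(j in [set~ i]) (G j `&` U)) `&`
       ~` (\bigcup_(j in [set~ i]) G j).
    rewrite splitD; apply/seteqP; split=> y.
      by move=> [xy nG]; split=> //; left.
    by move=> [[//|nU] nG]; split=> // yx; apply: nU; rewrite yx.
  apply: compact_closedI => //; apply: open_closedC.
  by apply: bigcup_open => j _; case: (oG j).
Qed.

(* Shrinking the star at [g z] into a compact neighbourhood C of [g z] carries it
   over to Y, where the complement of [f @` C] serves as one more member because
   Y is not compact. *)
Lemma star_option (X Y : topologicalType) (x : X) (y z : Y) (f : X -> Y)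
    (g : Y -> X) (I : finType) (G : I -> set X) :
  hausdorff_space X -> compact [set: X] ->
  hausdorff_space Y -> ~ compact [set: Y] -> z <> y ->
  homeo_on (~` [set x]) (~` [set y]) f g -> star (~` [set g z]) G ->
  exists G' : option I -> set Y, star (~` [set z]) G'.
Proof.
move=> X2 Xc Y2 Ync zy fg Gstar.
have [fAB gBA gf fgK _] := fg.
have gzx : g z <> x by exact: gBA.
have [U [V [oU oV Uz Vx UV0]]] := (hausdorffP X).1 X2 _ _ gzx.
(* [C] is a compact neighbourhood of [g z] avoiding [x], so [f] is a homeomorphism on it. *)
pose C := ~` V.
have UC : U `<=` C.
  by move=> w Uw Vw; have : (U `&` V) w by []; rewrite UV0.
have CA : C `<=` ~` [set x] by move=> w nV wx; apply: nV; rewrite wx.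
have cC : compact C.
  by apply: (subclosed_compact _ Xc) => //; exact: open_closedC.
have [oG GI cG ncG] := star_localize X2 Xc oU Uz Gstar.
set H := (fun i => G i `&` U) in oG GI cG ncG.
have HC i : H i `<=` C by move=> w [_ /UC].
have HA i : H i `<=` ~` [set x] by move=> w /HC /CA.
have oB := hausdorff_open_setC1 Y2 y.
have finj a b : (~` [set x]) a -> (~` [set x]) b -> f a = f b -> a = b.
  by move=> Aa Ab fab; rewrite -(gf a)// fab gf.
pose G' (o : option I) := if o is Some i then f @` H i else ~` (f @` C).
have fgz : f (g z) = z by exact: fgK.
(* Within the image of [C], complements at [z] are images of complements at [g z], so their
   compactness can be tested in [X]. *)
have imD (P : set I) : f @` C `&` (~` [set z] `\` \bigcup_(i in P) f @` H i) =
    f @` (C `&` (~` [set g z] `\` \bigcup_(i in P) H i)).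
  apply/seteqP; split=> w.
    move=> [[v Cv <-] [vz nH]]; exists v => //; split => //; split.
      by move=> vgz; apply: vz; rewrite vgz.
    by move=> [i Pi Hv]; apply: nH; exists i => //; exists v.
  move=> [v [Cv [vgz nH]] <-]; split; first by exists v.
  split; first by move=> fvz; apply: vgz; rewrite -fvz gf//; exact: CA.
  move=> [i Pi [u Hu uv]]; apply: nH; exists i => //.
  by rewrite -(finj u v)//; [exact: HA Hu|exact: CA].
have imDA (P : set I) :
    C `&` (~` [set g z] `\` \bigcup_(i in P) H i) `<=` ~` [set x].
  by move=> w [/CA].
have cfC : compact (f @` C) by exact/(homeo_on_compact fg).
have clC : closed C by exact: open_closedC.
exists G'; split.
- move=> [i|]; split.
  + by apply: (homeo_on_open fg) => //; case: (oG i).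
  + move=> _ [w Hw <-] fwz.
    have := (oG i).2 _ Hw; apply; rewrite /= -fwz gf//; exact: HA Hw.
  + by apply: closed_openC; exact: compact_closed.
  + by move=> w nC wz; apply: nC; exists (g z); [exact: UC|rewrite wz].
- move=> [i|] [j|] //=.
  + move=> [_ [[v Hv <-] [u Hu uv]]]; congr Some; apply: GI; exists v.
    split => //.
    by rewrite -(finj u v)//; [exact: HA Hu|exact: HA Hv].
  + by move=> [_ [[v /HC Cv <-]]] []; exists v.
  + by move=> [w [nC [v /HC Cv vw]]]; exfalso; apply: nC; exists v.
(* The member [None] removes everything outside the image of [C], so the remainder lies in that
   image. *)
- have -> : ~` [set z] `\` \bigcup_o G' o =
      f @` C `&` (~` [set z] `\` \bigcup_(i in [set: I]) f @` H i).
    apply/seteqP; split=> w.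
      move=> [wz nG]; split; last first.
        by split=> // -[i _ Hw]; apply: nG; exists (Some i).
      by apply: contrapT => nC; apply: nG; exists None.
    by move=> [Cw [wz nH]]; split=> // -[[i|] _] //= Hw; apply: nH; exists i.
  rewrite imD; apply/(homeo_on_compact fg) => //.
  by rewrite setIC; exact: compact_closedI.
- move=> [i|] cE.
    apply: (ncG i).
    (* All [H j] lie in [U], so outside [C] the complement only gains points of the compact
       complement of [U]. *)
    have -> : ~` [set g z] `\` \bigcup_(j in [set~ i]) H j =
        (C `&` (~` [set g z] `\` \bigcup_(j in [set~ i]) H j)) `|` ~` U.
      apply/seteqP; split=> w.
        move=> Dw; have [Uw|] := pselect (U w); [left|by right].
        by split => //; exact: UC.
      move=> [[]//|nU]; split; first by move=> wgz; apply: nU; rewrite wgz.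
      by move=> [j _ []].
    apply: compactU; last first.
      by apply: (subclosed_compact _ Xc) => //; exact: open_closedC.
    apply/(homeo_on_compact fg) => //; rewrite -imD.
    suff <- : ~` [set z] `\` \bigcup_(o in [set~ Some i]) G' o =
      f @` C `&` (~` [set z] `\` \bigcup_(j in [set~ i]) f @` H j) by [].
    apply/seteqP; split=> w.
      move=> [wz nG]; split; last first.
        by split=> // -[j ji Hw]; apply: nG; exists (Some j) => //= -[].
      by apply: contrapT => nC; apply: nG; exists None.
    move=> [Cw [wz nH]]; split=> // -[[j|] ji] //= Hw; apply: nH.
    exists j => //.
    by move=> /= ij; apply: ji; rewrite /= ij.
  (* With [None] dropped, a compact complement and the compact image of [C] would together exhaust
     [Y]. *)
  apply: Ync.
  suff -> : [set: Y] =
      (~` [set z] `\` \bigcup_(o in [set~ None]) G' o) `|` f @` C.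
    exact: compactU.
  apply/seteqP; split=> // w _.
  have [|nC] := pselect ((f @` C) w); [by right|left]; split.
    by move=> wz; apply: nC; exists (g z); [exact: UC|rewrite wz].
  by move=> [[i|] //= _ [v /HC Cv vw]]; apply: nC; exists v.
Qed.

(** * Uniqueness of the compact one-point extension *)

(** If an open [V] contains [y], its complement is compact and lies in the card, so the image under
    [g] is compact, hence closed in [X]. If [V] misses [y], continuity on the open card suffices. *)
Lemma one_point_extension_continuous (X Y : topologicalType) (x : X) (y : Y)
    (f : X -> Y) (g : Y -> X) :
  hausdorff_space X -> hausdorff_space Y -> compact [set: Y] ->
  homeo_on (~` [set x]) (~` [set y]) f g ->
  continuous (fun z => if pselect (z = x) then y else f z).
Proof.
move=> X2 Y2 Yc fg; have [fAB gBA gf fgK [cf cg]] := fg.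
apply/continuousP => V oV.
have [Vy|nVy] := pselect (V y).
  have -> : (fun z => if pselect (z = x) then y else f z) @^-1` V =
      ~` (g @` ~` V).
    apply/seteqP; split=> z /=; case: pselect => zx.
    - move=> _ [w nVw gw]; apply: (gBA w); last by rewrite gw.
      by move=> wy; apply: nVw; rewrite wy.
    - move=> Vz [w nVw gw]; have wy : w <> y.
        by move=> wy; apply: nVw; rewrite wy.
      by apply: nVw; rewrite -(fgK w wy) gw.
    - by [].
    - move=> nV; apply: contrapT => nVz; apply: nV; exists (f z) => //.
      exact: gf.
  apply: closed_openC; apply: compact_closed => //.
  apply/(homeo_on_compact (homeo_on_sym fg)).
    by move=> w nV wy; apply: nV; rewrite wy.
  by apply: (subclosed_compact _ Yc) => //; exact: open_closedC.
have -> : (fun z => if pselect (z = x) then y else f z) @^-1` V =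
    ~` [set x] `&` f @^-1` V.
  by apply/seteqP; split=> z /=; case: pselect => zx //; move=> [].
have oA := hausdorff_open_setC1 X2 x.
by move/(continuous_inP _ oA) : cf; exact.
Qed.

Lemma one_point_extension_homeomorphic (X Y : topologicalType) (x : X) (y : Y)
    (f : X -> Y) (g : Y -> X) :
  hausdorff_space X -> hausdorff_space Y ->
  compact [set: X] -> compact [set: Y] ->
  homeo_on (~` [set x]) (~` [set y]) f g -> homeomorphic X Y.
Proof.
move=> X2 Y2 Xc Yc fg; have [fAB gBA gf fgK _] := fg.
exists (fun z => if pselect (z = x) then y else f z).
exists (fun w => if pselect (w = y) then x else g w); split.
- exact: (one_point_extension_continuous X2 Y2 Yc fg).
- exact: (one_point_extension_continuous Y2 X2 Xc (homeo_on_sym fg)).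
- move=> z /=; case: (pselect (z = x)) => zx /=.
    by case: (pselect (y = y)).
  by case: (pselect (f z = y)) => [fzy|nfz] /=; [have := fAB _ zx|exact: gf].
- move=> w /=; case: (pselect (w = y)) => wy /=.
    by case: (pselect (x = x)).
  by case: (pselect (g w = x)) => [gwx|ngw] /=; [have := gBA _ wy|exact: fgK].
Qed.

(** * Properties shared by spaces with equal decks *)

Lemma homeomorphic_refl (X : topologicalType) : homeomorphic X X.
Proof. by exists id, id; split=> // x; exact: cvg_id. Qed.

Lemma deck_card (X Y : topologicalType) (y : Y) : deck X = deck Y ->
  exists x : X, homeomorphic (point_deleted x) (point_deleted y).
Proof.
move=> XY; have : deck X (homeo_class (point_deleted y)).
  by rewrite XY; exists y.
move=> [x yx]; exists x.
change (homeo_class (point_deleted x) (point_deleted y)).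
by rewrite -yx; exact: homeomorphic_refl.
Qed.

Lemma point_deleted_homeo_on (X Y : topologicalType) (x a : X) (y : Y) :
  hausdorff_space X -> hausdorff_space Y -> a <> x ->
  homeomorphic (point_deleted x) (point_deleted y) ->
  exists f g, homeo_on (~` [set x]) (~` [set y]) f g.
Proof.
move=> X2 Y2 ax /homeomorphic_homeo_on[f [g fg]].
pose z : point_deleted x := SigSub (mem_set (ax : (~` [set x]) a)).
have [h hx] := set_type_homeo_on z (hausdorff_open_setC1 X2 x).
have [k ky] := set_type_homeo_on (f z) (hausdorff_open_setC1 Y2 y).
have := homeo_on_trans (homeo_on_trans (homeo_on_sym hx) fg) ky.
by do 2!eexists; eassumption.
Qed.

Definition avoids_two (X : topologicalType) : Prop :=
  forall a b : X, exists c, c <> a /\ c <> b.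

Lemma card_ge3_avoids_two (X : topologicalType) :
  `I_3 #<= [set: X] -> avoids_two X.
Proof.
move=> /card_leP[f] a b; apply: contrapT => /forallNP nc.
pose v i (i3 : `I_3 i) := set_val (f (SigSub (mem_set i3))).
have vab i i3 : @v i i3 = a \/ v i i3 = b.
  have [|va] := pselect (v i i3 = a); [by left|right].
  by apply: contrapT => vb; exact: (nc (v i i3)).
have vinj i j i3 j3 : v i i3 = v j j3 -> i = j.
  by move=> /val_inj /(inj (in_setT _) (in_setT _)) /(congr1 val).
have [v0|v0] := vab 0 isT; have [v1|v1] := vab 1 isT; have [v2|v2] := vab 2 isT;
  by [have := vinj 0 1 isT isT; rewrite v0 v1 => /(_ erefl)
    |have := vinj 0 2 isT isT; rewrite v0 v2 => /(_ erefl)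
    |have := vinj 1 2 isT isT; rewrite v1 v2 => /(_ erefl)].
Qed.

(** The card at [a] is a copy of a card of [X] and so has two points, of which at most one is
    [b]. *)
Lemma deck_avoids_two (X Y : topologicalType) :
  deck X = deck Y -> avoids_two X -> avoids_two Y.
Proof.
move=> XY X3 a b; have [x [f [g [_ _ fK _]]]] := deck_card a XY.
have [p [px _]] := X3 x x; have [q [qx qp]] := X3 x p.
pose p' : point_deleted x := SigSub (mem_set (px : (~` [set x]) p)).
pose q' : point_deleted x := SigSub (mem_set (qx : (~` [set x]) q)).
have fpq : set_val (f q') <> set_val (f p').
  by move=> /val_inj /(can_inj fK) /(congr1 val).
have [pb|pb] := pselect (set_val (f p') = b).
  by exists (set_val (f q')); split; [exact: (set_valP (f q'))|rewrite -pb].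
by exists (set_val (f p')); split => //; exact: (set_valP (f p')).
Qed.

(** Cards of [Y] are Hausdorff, being copies of cards of [X]. Separating two points in the card at a
    third point [c] gives open sets of [Y] meeting at most in [c]; this makes points closed, after
    which [c] can be removed. *)
Lemma deck_hausdorff (X Y : topologicalType) :
  deck X = deck Y -> avoids_two Y -> hausdorff_space X -> hausdorff_space Y.
Proof.
move=> XY Y3 X2.
have sep c a b : a <> c -> b <> c -> a <> b -> exists U V : set Y,
    [/\ open U, open V, U a, V b & U `&` V `<=` [set c]].
  move=> ac bc ab; have [x [f [g [_ cg _ gK]]]] := deck_card c XY.
  have /hausdorffP c2 : hausdorff_space (point_deleted c).
    apply: (hausdorff_inj cg (can_inj gK)); exact: hausdorff_point_deleted.
  pose pt d (dc : d <> c) : point_deleted c :=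
    SigSub (mem_set (dc : (~` [set c]) d)).
  have [|_ [_ [[U oU <-] [V oV <-] Ua Vb UV0]]] := c2 (pt a ac) (pt b bc).
    by move/(congr1 val).
  exists U, V; split => // d [Ud Vd]; apply: contrapT => dc.
  have : (set_val @^-1` U `&` set_val @^-1` V) (pt d dc) by [].
  by rewrite UV0.
have oC1 c : open (~` [set c] : set Y).
  rewrite openE => a ac.
  have [d [da dc]] := Y3 a c.
  have [|||U [V [oU oV Ua Vc UV]]] := sep d a c; try by [] || exact: nesym.
  apply: (@filterS _ _ _ U) => [e Ue ec|]; last exact: open_nbhs_nbhs.
  by apply: dc; rewrite -(UV c)//; split=> //; rewrite -ec.
apply/hausdorffP => a b ab; have [c [ca cb]] := Y3 a b.
have [|||U [V [oU oV Ua Vb UV]]] := sep c a b; try by [] || exact: nesym.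
exists (U `&` ~` [set c]), V; split => //; first exact: openI.
  by split => // ac; apply: ca.
by apply/seteqP; split=> // d [[Ud dc] Vd]; apply: dc; exact: UV.
Qed.

(** * Minimal star bound and reconstruction *)

Theorem theorem3p11 (X : topologicalType)
    (X3 : `I_3 #<= [set: X])
    (Xhausdorff : hausdorff_space X)
    (Xcompact : compact [set: X])
    (Xcard : exists (x : X) (N : nat),
       has_maximal_npoint_compactification N (point_deleted x)) :
  topologically_reconstructible X.
Proof.
move=> Y XY.
have Xa := card_ge3_avoids_two X3.
have Ya := deck_avoids_two XY Xa.
have Yhausdorff := deck_hausdorff XY Ya Xhausdorff.
have cardY (y : Y) : exists (x : X) f g, homeo_on (~` [set x]) (~` [set y]) f g.
  have [x xy] := deck_card y XY; have [a [ax _]] := Xa x x.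
  by exists x; exact: (point_deleted_homeo_on Xhausdorff Yhausdorff ax xy).
have cardX (x : X) : exists (y : Y) f g, homeo_on (~` [set x]) (~` [set y]) f g.
  have [y yx] := deck_card x (esym XY); have [b [yb _]] := Ya y y.
  have [g [f gf]] := point_deleted_homeo_on Yhausdorff Xhausdorff yb yx.
  by exists y, f, g; exact: homeo_on_sym.
suff Yc : compact [set: Y].
  have [x _] := Xcard; have [y [f [g fg]]] := cardX x.
  exact: (one_point_extension_homeomorphic Xhausdorff Yhausdorff _ _ fg).
apply: contrapT => Ync.
have {Xcard} exN : exists N, `[< exists x : X, star_bounded x N >].
  have [x [N xN]] := Xcard; exists N; apply/asboolP; exists x.
  have [a [ax _]] := Xa x x.
  exact: (maximal_npoint_star_bounded Xhausdorff Xcompact ax xN).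
(* [N] is the least star bound over all points of [X], attained at [x]. *)
have [N /asboolP[x xN] Nmin] := ex_minnP exN.
have [y [f [g fg]]] := cardX x.
(* Any second point [y'] will do: [y] survives in the card at [y'], and [k y] is its copy in [X]. *)
have [y' [y'y _]] := Ya y y.
have [x' [h [k hk]]] := cardY y'.
(* A star at [k y] gives one at [y] with one more member, which moves to [x] through the common
   card; hence [#|I| + 1 <= N]. *)
have step (I : finType) (G : I -> set X) : star (~` [set k y]) G -> #|I| < N.
  move=> Gstar.
  have [|G' Gstar'] :=
    star_option Xhausdorff Xcompact Yhausdorff Ync _ hk Gstar.
    exact: nesym.
  rewrite -card_option; apply: xN.
  apply: (star_homeo_on (homeo_on_sym fg) _ Gstar').
  exact: hausdorff_open_setC1.
(* Some star at [k y] exists, so [N] is positive and [N.-1], which bounds the stars at [k y], is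
   strictly below the minimum. *)
have [I [G Gstar]] := star_exists (hausdorff_open_setC1 Xhausdorff (k y)).
have N0 : 0 < N by apply: leq_ltn_trans (step _ _ Gstar).
have /Nmin : `[< exists x : X, star_bounded x N.-1 >].
  by apply/asboolP; exists (k y) => J F /step; case: (N) N0.
by rewrite leqNgt ltn_predL N0.
Qed.
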